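(* Given an edge-colored directed graph $(G,f)$, the algebra $A(G,f)$, i.e. a norm closed operator algebra satisfying the universal property for contractive representations of $(G,f)$, exists and is unique.
   Context: A directed graph $G=(V,E,r,s)$ has vertex set $V$, edge set $E$, and range and source maps $r,s:E\to V$. An edge-colored directed graph $(G,f)$ is a directed graph $G$ with a function $f:E\to\mathbb{N}=\{1,2,\dots\}$. A contractive representation $\pi:G\to B(\mathcal{H})$ of a directed graph assigns to the vertices $v$ pairwise orthogonal projections $\pi(v)$ and to the edges $e$ operators $\pi(e)$ with $\pi(e)=\pi(r(e))\pi(e)\pi(s(e))$ such that the row operator $[\pi(e)]_{e\in E}$ is a contraction (i.e. $\sum_{e\in F}\pi(e)\pi(e)^*\le I$ for every finite $F\subseteq E$). A map $\pi:G\to B(\mathcal{H})$ is a contractive representation of $(G,f)$ if its restriction to the directed graph $(V,f^{-1}(j),r,s)$ is a contractive representation for each $j\in\mathbb{N}$. The same terminology is used for maps into an operator algebra. Universal property for $A(G,f)$: there exists a contractive representation $\iota:G\to A(G,f)$ of $(G,f)$, whose image generates $A(G,f)$ as a norm closed algebra, such that for every contractive representation $\pi:G\to B(\mathcal{H})$ of $(G,f)$ there exists a unique completely contractive representation $\tilde\pi:A(G,f)\to B(\mathcal{H})$ with $\tilde\pi\circ\iota=\pi$. Uniqueness is in the usual sense for universal objects: up to completely isometric isomorphism compatible with the maps $\iota$. *)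

(* Defs.v *)
From HB Require Import structures.
From mathcomp Require Import all_boot all_order all_algebra.
From mathcomp Require Import sesquilinear complex.
From mathcomp Require Import all_classical all_reals all_analysis.

Set Implicit Arguments.
Unset Strict Implicit.
Unset Printing Implicit Defensive.

Import Order.TTheory GRing.Theory Num.Theory.
Import numFieldNormedType.Exports.

Local Open Scope classical_set_scope.
Local Open Scope complex_scope.
Local Open Scope ring_scope.

(* The inner product is linear in its first argument. *)
Record hilbert (R : realType) := Hilbert {
  hilbert_sort :> completeNormedModType R[i];
  inner : {dot hilbert_sort for Num.conj};
  sqr_norm_inner : forall x : hilbert_sort, `|x| ^+ 2 = inner x x }.

(* The library norm takes values in R[i]; its real part is the real norm. *)
Definition rnorm (R : realType) (V : normedModType R[i]) (x : V) : R :=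
  complex.Re `|x|.

Lemma RRe_normC (R : realType) (c : R[i]) : (complex.Re `|c|)%:C = `|c|.
Proof. by rewrite RRe_real. Qed.

Lemma real_complexM (R : realType) (a b : R) : (a * b)%:C = a%:C * b%:C :> R[i].
Proof. exact: rmorphM. Qed.

Lemma Re_normC_ge0 (R : realType) (c : R[i]) : 0 <= complex.Re `|c|.
Proof. by rewrite -lecR RRe_normC normr_ge0. Qed.

Lemma Re_normC_gt0 (R : realType) (c : R[i]) :
  (0 < complex.Re `|c|) = (c != 0).
Proof.
rewrite lt_neqAle Re_normC_ge0 andbT eq_sym; congr (~~ _).
apply/eqP/eqP => [h|->]; last by rewrite normr0.
by apply/normr0_eq0; rewrite -RRe_normC h.
Qed.

Lemma Re_normCV (R : realType) (c : R[i]) :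
  complex.Re `|c^-1| = (complex.Re `|c|)^-1.
Proof.
apply: complexI; rewrite RRe_normC normfV -RRe_normC.
exact: esym (fmorphV (real_complex R) _).
Qed.

Section RNorm.
Variables (R : realType) (V : normedModType R[i]).
Implicit Types x y : V.

Lemma rnormE x : (rnorm x)%:C = `|x|.
Proof. by rewrite /rnorm RRe_real. Qed.

Lemma rnorm_ge0 x : 0 <= rnorm x.
Proof. by rewrite -lecR rnormE normr_ge0. Qed.

Lemma rnormD x y : rnorm (x + y) <= rnorm x + rnorm y.
Proof. by rewrite -lecR rmorphD/= !rnormE ler_normD. Qed.

Lemma rnormZ c x : rnorm (c *: x) = complex.Re `|c| * rnorm x.
Proof.
by apply: complexI; rewrite real_complexM RRe_normC !rnormE normrZ.
Qed.

Lemma rnorm_eq0 x : rnorm x = 0 -> x = 0.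
Proof. by move=> h; apply/normr0_eq0; rewrite -rnormE h. Qed.

Lemma rnorm0 : rnorm (0 : V) = 0.
Proof. by rewrite /rnorm normr0. Qed.

End RNorm.

Section BoundedOperators.
Variables (R : realType) (H : hilbert R).

Definition bounded_operator : {pred H -> H} :=
  [pred T | `[< linear T /\ continuous T >]].

Record bop := Bop { bop_fun :> H -> H; bopP : bop_fun \in bounded_operator }.

HB.instance Definition _ := [isSub for bop_fun].
HB.instance Definition _ := [Choice of bop by <:].

Lemma bop_linear (T : bop) : linear T.
Proof. by case: T => f /= /asboolP[]. Qed.

Lemma bop_continuous (T : bop) : continuous T.
Proof. by case: T => f /= /asboolP[]. Qed.

HB.instance Definition _ (T : bop) :=
  GRing.isLinear.Build R[i] H H *:%R (bop_fun T) (@bop_linear T).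

Lemma bounded_operator_submod : submod_closed bounded_operator.
Proof.
split.
  by apply/asboolP; split=> [c x y|x]; rewrite ?scaler0 ?addr0//; exact: cvg_cst.
move=> c S T /asboolP[Sl Sc] /asboolP[Tl Tc]; apply/asboolP; split.
  have E z : (c *: S + T) z = c *: S z + T z by [].
  move=> d x y; rewrite !E Sl Tl !scalerDr !scalerA.
  by rewrite (mulrC c d) addrACA.
by move=> x; apply: cvgD (Tc x); apply: cvgZr (Sc x).
Qed.
HB.instance Definition _ :=
  GRing.isSubmodClosed.Build _ _ bounded_operator bounded_operator_submod.
HB.instance Definition _ := [SubChoice_isSubLmodule of bop by <:].


Definition unit_ball : set H := [set x | rnorm x <= 1].

Definition opnorm (T : bop) : R := sup [set rnorm (T x) | x in unit_ball].

Lemma unit_ball0 : unit_ball 0.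
Proof. by rewrite /unit_ball/= rnorm0. Qed.

Lemma opnorm_has_sup (T : bop) : has_sup [set rnorm (T x) | x in unit_ball].
Proof.
split; first by exists (rnorm (T 0)); exists 0 => //; exact: unit_ball0.
have /linear_bounded_continuous/bounded_funP/(_ 1)[M hM] := @bop_continuous T.
exists (complex.Re M) => _ [x x1 <-].
have : `|T x| <= M by apply: hM; rewrite -rnormE (lecR _ 1).
by rewrite lecE => /andP[].
Qed.

Lemma opnorm_ub (T : bop) x : unit_ball x -> rnorm (T x) <= opnorm T.
Proof.
by move=> x1; apply: sup_upper_bound; [exact: opnorm_has_sup|exists x].
Qed.

Lemma opnorm_le (T : bop) (M : R) :
  (forall x, unit_ball x -> rnorm (T x) <= M) -> opnorm T <= M.
Proof.
move=> hM; apply: ge_sup; first by case: (opnorm_has_sup T).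
by move=> _ [x x1 <-]; exact: hM.
Qed.

Lemma opnorm_ge0 (T : bop) : 0 <= opnorm T.
Proof. exact: le_trans (rnorm_ge0 _) (opnorm_ub T unit_ball0). Qed.

Lemma opnormP (T : bop) x : rnorm (T x) <= opnorm T * rnorm x.
Proof.
have [->|x0] := eqVneq x 0; first by rewrite linear0 !rnorm0 mulr0.
have rx0 : 0 < rnorm x.
  by rewrite lt_neqAle rnorm_ge0 eq_sym andbT; apply: contra_neq x0; exact: rnorm_eq0.
have cE : complex.Re `|(rnorm x)^-1%:C : R[i]| = (rnorm x)^-1.
  by rewrite ger0_norm// lecR invr_ge0 ltW.
have : rnorm (T ((rnorm x)^-1%:C *: x)) <= opnorm T.
  by apply: opnorm_ub; rewrite /unit_ball/= rnormZ cE mulVf// gt_eqF.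
by rewrite linearZ rnormZ cE mulrC ler_pdivrMr.
Qed.

Let norm (T : bop) : R[i] := (opnorm T)%:C.

Lemma opnormD (S T : bop) : norm (S + T) <= norm S + norm T.
Proof.
rewrite /norm -rmorphD lecR; apply: opnorm_le => x x1.
by apply: le_trans (rnormD _ _) _; apply: lerD; exact: opnorm_ub.
Qed.

Lemma opnormZ (c : R[i]) (T : bop) : norm (c *: T) = `|c| * norm T.
Proof.
have le d S : opnorm (d *: S) <= complex.Re `|d| * opnorm S.
  apply: opnorm_le => x x1; rewrite [X in rnorm X](_ : _ = d *: S x)// rnormZ.
  by apply: ler_wpM2l; [exact: Re_normC_ge0|exact: opnorm_ub].
rewrite /norm -(RRe_normC c) -real_complexM; congr (_%:C).
apply/eqP; rewrite eq_le le andTb.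
have [->|c0] := eqVneq c 0; first by rewrite normr0 mul0r opnorm_ge0.
have := le c^-1 (c *: T); rewrite scalerA mulVf// scale1r Re_normCV.
by rewrite ler_pdivlMl// Re_normC_gt0.
Qed.

Lemma opnorm_eq0 (T : bop) : norm T = 0 -> T = 0.
Proof.
move=> [T0]; apply/val_inj/funext => x; apply: rnorm_eq0.
apply/eqP; rewrite eq_le rnorm_ge0 andbT.
by apply: le_trans (opnormP T x) _; rewrite T0 mul0r.
Qed.

HB.instance Definition _ :=
  Lmodule_isNormed.Build R[i] bop opnormD opnormZ opnorm_eq0.

Lemma bop_id_subproof : idfun \in bounded_operator.
Proof. by apply/asboolP; split=> // x; exact: cvg_id. Qed.
Definition bop_id := Bop bop_id_subproof.

Lemma bop_comp_subproof (S T : bop) : S \o T \in bounded_operator.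
Proof.
apply/asboolP; split=> [c x y|x]; first by rewrite /= !linearP.
by apply: continuous_comp; exact: bop_continuous.
Qed.
Definition bop_comp (S T : bop) := Bop (bop_comp_subproof S T).

Let bop_compA : associative bop_comp.
Proof. by move=> S T U; exact/val_inj. Qed.
Let bop_comp1 : left_id bop_id bop_comp.
Proof. by move=> S; exact/val_inj. Qed.
Let bop_compr1 : right_id bop_id bop_comp.
Proof. by move=> S; exact/val_inj. Qed.
Let bop_compDl : left_distributive bop_comp +%R.
Proof. by move=> S T U; exact/val_inj. Qed.
Let bop_compDr : right_distributive bop_comp +%R.
Proof. by move=> S T U; apply/val_inj/funext => x /=; rewrite linearD. Qed.

HB.instance Definition _ := GRing.Zmodule_isPzRing.Build bop
  bop_compA bop_comp1 bop_compr1 bop_compDl bop_compDr.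

End BoundedOperators.

Section MatrixNorms.
Variables (R : realType) (H : hilbert R).

Definition l2norm n (x : 'I_n -> H) : R :=
  Num.sqrt (\sum_(j < n) rnorm (x j) ^+ 2).

Definition mx_act m n (T : 'M[bop H]_(m, n)) (x : 'I_n -> H) : 'I_m -> H :=
  fun i => \sum_(j < n) T i j (x j).

(* The operator norm of T as an operator from H^n to H^m. *)
Definition mxnorm m n (T : 'M[bop H]_(m, n)) : R :=
  sup [set l2norm (mx_act T x) | x in [set x : 'I_n -> H | l2norm x <= 1]].

End MatrixNorms.

Section OperatorAlgebras.
Variable R : realType.

(* Subalgebras need not contain the identity operator. *)
Definition closed_subalgebra (H : hilbert R) (A : set (bop H)) : Prop :=
  [/\ A 0,
      forall (c : R[i]) S T, A S -> A T -> A (c *: S + T),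
      forall S T, A S -> A T -> A (S * T)
    & closed A].

Record operator_algebra := OperatorAlgebra {
  oa_space : hilbert R;
  oa_set :> set (bop oa_space);
  oa_closed_subalgebra : closed_subalgebra oa_set }.
Arguments oa_set : clear implicits.

(* Maps out of an operator algebra A are represented by functions on all of
   bop (oa_space A), of which only the values on A are relevant. *)
Section Representations.
Variables (A : operator_algebra) (H : hilbert R).
Variable phi : bop (oa_space A) -> bop H.

Definition homomorphism_on : Prop :=
  (forall (c : R[i]) S T, oa_set A S -> oa_set A T ->
     phi (c *: S + T) = c *: phi S + phi T)
  /\ (forall S T, oa_set A S -> oa_set A T -> phi (S * T) = phi S * phi T).

Definition completely_contractive : Prop :=
  forall n (T : 'M[bop (oa_space A)]_n),
    (forall i j, oa_set A (T i j)) -> mxnorm (map_mx phi T) <= mxnorm T.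

Definition completely_isometric : Prop :=
  forall n (T : 'M[bop (oa_space A)]_n),
    (forall i j, oa_set A (T i j)) -> mxnorm (map_mx phi T) = mxnorm T.

Definition completely_contractive_representation : Prop :=
  homomorphism_on /\ completely_contractive.

End Representations.

Arguments homomorphism_on A {H} phi.
Arguments completely_contractive A {H} phi.
Arguments completely_isometric A {H} phi.
Arguments completely_contractive_representation A {H} phi.

Definition completely_isometric_isomorphism (A B : operator_algebra)
    (phi : bop (oa_space A) -> bop (oa_space B)) : Prop :=
  [/\ homomorphism_on A phi, set_bij A B phi & completely_isometric A phi].

End OperatorAlgebras.

Arguments oa_set {R} o _.

Arguments homomorphism_on {R} A {H} phi.
Arguments completely_contractive {R} A {H} phi.
Arguments completely_isometric {R} A {H} phi.
Arguments completely_contractive_representation {R} A {H} phi.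
Arguments completely_isometric_isomorphism {R} A B phi.

Record digraph := Digraph {
  vertex : Type;
  edge : Type;
  rng : edge -> vertex;
  src : edge -> vertex }.

Definition digraph_elt (G : digraph) : Type := (vertex G + edge G)%type.

Section GraphRepresentations.
Variables (R : realType) (H : hilbert R).

Definition is_projection (P : bop H) : Prop :=
  P * P = P /\ forall x y, inner H (P x) y = inner H x (P y).

(* The row operator [T_e]_{e in E} is a contraction iff all its finite subrows
   are, which is equivalent to: the sum of T_e T_e^* over F is at most I for
   all finite F. *)
Definition row_contraction (E : Type) (T : E -> bop H) : Prop :=
  forall n (e : 'I_n -> E), injective e -> mxnorm (\row_j T (e j)) <= 1.

Definition contractive_rep (G : digraph) (pi : digraph_elt G -> bop H) : Prop :=
  [/\ forall v, is_projection (pi (inl v)),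
      forall v w, v <> w -> pi (inl v) * pi (inl w) = 0,
      forall e, pi (inr e) = pi (inl (rng e)) * pi (inr e) * pi (inl (src e))
    & row_contraction (fun e => pi (inr e))].

Definition color_subgraph (G : digraph) (f : edge G -> nat) (j : nat) :=
  @Digraph (vertex G) {e : edge G | f e = j}
    (fun e => rng (sval e)) (fun e => src (sval e)).

Definition restrict_color (G : digraph) (f : edge G -> nat) (j : nat)
    (pi : digraph_elt G -> bop H) (x : digraph_elt (color_subgraph f j)) :=
  match x with
  | inl v => pi (inl v)
  | inr e => pi (inr (sval e))
  end.

Definition contractive_colored_rep (G : digraph) (f : edge G -> nat)
    (pi : digraph_elt G -> bop H) : Prop :=
  forall j, (0 < j)%N -> contractive_rep (@restrict_color G f j pi).

End GraphRepresentations.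

Definition universal_algebra (R : realType) (G : digraph) (f : edge G -> nat)
    (A : operator_algebra R) (iota : digraph_elt G -> bop (oa_space A)) : Prop :=
  [/\ contractive_colored_rep f iota,
      smallest (@closed_subalgebra R (oa_space A)) (range iota) = A
    & forall (H : hilbert R) (pi : digraph_elt G -> bop H),
        contractive_colored_rep f pi ->
        exists2 phi : bop (oa_space A) -> bop H,
          completely_contractive_representation A phi /\ phi \o iota = pi
        & forall psi : bop (oa_space A) -> bop H,
            completely_contractive_representation A psi -> psi \o iota = pi ->
            forall T, oa_set A T -> phi T = psi T].

Arguments universal_algebra {R G} f A iota.

(* Main.v *)
From HB Require Import structures.
Require Import Defs.
From mathcomp Require Import all_boot all_order all_algebra.
From mathcomp Require Import finmap sesquilinear complex.
From mathcomp Require Import all_classical all_reals all_analysis.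
From mathcomp Require Import summability ring.

Set Implicit Arguments.
Unset Strict Implicit.
Unset Printing Implicit Defensive.

Import Order.TTheory GRing.Theory Num.Theory.
Import numFieldNormedType.Exports.

Local Open Scope classical_set_scope.
Local Open Scope complex_scope.
Local Open Scope ring_scope.

#[local] Existing Instance totally_filter.

(** Existence rests on a direct sum of representations. For every contractive
representation [pi] of the colored graph, a noncommutative polynomial in the
vertices and edges can be evaluated at [pi]. Relations between projections
and contractivity of rows hold in a Hilbert space direct sum as soon as they
hold in each summand, so the diagonal operators of a family of contractive
representations form again such a representation; all vertices and edges act
as contractions, so these diagonal operators are bounded. Let [iota] be the
direct sum of a family rich enough that every matrix [p] of polynomials
satisfies

  |p(pi)| <= |p(iota)|   for all contractive representations pi     (D)

([universal_rep_dominates]). The norm closed algebra generated by the values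
of [iota] is then universal. By (D) for matrices of size 1, the assignment
p(iota) |-> p(pi) is well defined and contractive; since B(H) is complete
([bop_complete]) it extends to the closure, and (D) for all sizes makes the
extension completely contractive ([dominated_extension]). It is unique because
two completely contractive representations agree on a closed subalgebra
([rep_unique]).

All contractive representations together are too many for a direct sum. The
family is therefore indexed by triples of a size, a matrix [p] of polynomials
of that size, and a real number [q] such that |p(pi)| >= q for at least one
contractive representation [pi], and for each triple one such [pi] is chosen.
Taking q := |p(pi)| shows that (D) holds for this family.

Uniqueness is the usual argument for universal objects: the two comparison
maps are completely contractive, each maps one algebra into the other because
preimages of closed subalgebras are closed subalgebras
([closed_subalgebra_preimage]), and they are mutually inverse by uniqueness,
hence completely isometric. *)

(** * Norms and limits *)

Lemma rnorm_distC (R : realType) (V : normedModType R[i]) (x y : V) :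
  rnorm (x - y) = rnorm (y - x).
Proof. by rewrite /rnorm distrC. Qed.

Lemma rnormN (R : realType) (V : normedModType R[i]) (x : V) :
  rnorm (- x) = rnorm x.
Proof. by rewrite /rnorm normrN. Qed.

Lemma rnorm_sum (R : realType) (V : normedModType R[i]) n (x : 'I_n -> V) :
  rnorm (\sum_j x j) <= \sum_j rnorm (x j).
Proof.
elim/big_rec2: _ => [|j a b _ ab]; first by rewrite rnorm0.
by apply: le_trans (rnormD _ _) _; rewrite lerD2l.
Qed.

Section RealConvergence.
Variables (R : realType) (T : Type) (F : set_system T) (FF : Filter F).
(* the type under which R[i] carries the topology of a number field *)
Local Notation C := (R[i] : numFieldType).

Lemma gt0_complexE (e : R[i]) : 0 < e -> exists2 r : R, 0 < r & e = r%:C.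
Proof.
case: e => a b; rewrite ltcE /= => /andP[/eqP -> a0].
by exists a.
Qed.

Lemma cvg_rnormP (V : normedModType R[i]) (f : T -> V) (l : V) :
  f @ F --> l <->
  forall e : R, 0 < e -> \forall x \near F, rnorm (l - f x) <= e.
Proof.
split=> [/cvgrPdist_le h e e0|h].
  have e0' : (0 : R[i]) < e%:C by rewrite ltcR.
  by apply: filterS (h _ e0') => x; rewrite -rnormE lecR.
apply/cvgrPdist_le => _ /gt0_complexE[e e0 ->].
by apply: filterS (h _ e0) => x; rewrite -rnormE lecR.
Qed.

Lemma cvg_real_complex (f : T -> R) (l : R) :
  f @ F --> l -> (fun x => (f x)%:C : C) @ F --> (l%:C : C).
Proof.
move=> /cvgrPdist_le h; apply/cvgrPdist_le => _ /gt0_complexE[e e0 ->].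
apply: filterS (h _ e0) => x; rewrite -rmorphB normc_def /= expr0n addr0.
by rewrite sqrtr_sqr lecR.
Qed.

Lemma cvg_conjC (f : T -> C) (l : C) :
  f @ F --> l -> (fun x => (f x)^* : C) @ F --> (l^* : C).
Proof.
move=> /cvgrPdist_le h; apply/cvgrPdist_le => e e0.
by apply: filterS (h _ e0) => x; rewrite -rmorphB norm_conjC.
Qed.

Lemma cvg_rnorm (V : normedModType R[i]) (f : T -> V) (l : V) :
  f @ F --> l -> (fun x => rnorm (f x)) @ F --> rnorm l.
Proof.
move=> /cvg_rnormP h; apply/cvgrPdist_le => e e0.
apply: filterS (h _ e0) => x; apply: le_trans.
have le a b : rnorm a - rnorm b <= rnorm (a - b :> V).
  by rewrite lerBlDr -{1}(subrK b a) rnormD.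
by rewrite ler_norml le andbT lerNl opprB rnorm_distC le.
Qed.

End RealConvergence.

Section RnormTopology.
Variables (R : realType) (V : normedModType R[i]).

(** Closedness tested with real radii, as all norm estimates below are made in
[R] rather than in [R[i]]. *)
Lemma closed_rnormP (A : set V) :
  (forall x,
    (forall e : R, 0 < e -> exists2 y, A y & rnorm (x - y) <= e) -> A x)
  <-> closed A.
Proof.
split=> [h x clx|cA x hx].
  apply: h => e e0; have e0' : (0 : R[i]) < e%:C by rewrite ltcR.
  have [y [Ay xy]] := clx _ (nbhsx_ballx x _ e0').
  exists y => //; move: xy; rewrite -ball_normE /ball_/= -rnormE ltcR.
  exact: ltW.
apply: cA => B /nbhs_ballP[_ /gt0_complexE[e e0 ->] eB].
have [|y Ay xy] := hx (e / 2); first by rewrite divr_gt0.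
exists y; split=> //; apply: eB; rewrite -ball_normE /ball_/= -rnormE ltcR.
by apply: le_lt_trans xy _; rewrite ltr_pdivrMr// ltr_pMr// ltr1n.
Qed.

Lemma rnorm_le0P (x : V) : (forall e : R, 0 < e -> rnorm x <= e) -> x = 0.
Proof.
move=> h; apply: rnorm_eq0; apply/eqP; rewrite eq_le rnorm_ge0 andbT.
by apply/ler_addgt0Pl => e e0; rewrite addr0; exact: h.
Qed.

End RnormTopology.

(** * Hilbert space direct sums *)

Section HilbertIdentities.
Variables (R : realType) (H : hilbert R).

Lemma inner_rnorm (x : H) : inner H x x = (rnorm x ^+ 2)%:C.
Proof. by rewrite -sqr_norm_inner -rnormE expr2 -real_complexM -expr2. Qed.

(** Reduces the convergence of sums of inner products to that of sums of
squared norms, which increase with the set of indices. *)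
Lemma polarization (x y : H) :
  inner H x y = 4^-1 * (inner H (x + y) (x + y) - inner H (x - y) (x - y)
    + 'i * (inner H (x + 'i *: y) (x + 'i *: y)
      - inner H (x - 'i *: y) (x - 'i *: y))).
Proof.
rewrite !dnormB !dnormD !linearZr_LR /=.
set d := inner H x y.
rewrite !rmorphM /= conjCK conjCi.
transitivity (4^-1 * (2 * (d + d^*) + 2 * (- ('i * 'i) * d + ('i * 'i) * d^*))).
  rewrite -!expr2 sqrCi.
  by field.
by congr (_ * _); ring.
Qed.

(** The weights absorb the mixed term of the square, as
2ab <= (t/s) a^2 + (s/t) b^2. When [s] and [t] are the norms of two vectors,
the right-hand side sums up to (s + t)^2, whence the triangle inequality in
direct sums. *)
Lemma sqr_rnormD (x y : H) (s t : R) : 0 < s -> 0 < t ->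
  rnorm (x + y) ^+ 2 <= (1 + t / s) * rnorm x ^+ 2 + (1 + s / t) * rnorm y ^+ 2.
Proof.
move=> s0 t0; have st : 0 < s * t by rewrite mulr_gt0.
apply: (@le_trans _ _ ((rnorm x + rnorm y) ^+ 2)).
  by rewrite ler_sqr ?nnegrE ?addr_ge0 ?rnorm_ge0// rnormD.
rewrite -subr_ge0.
rewrite (_ : _ - _ = (t * rnorm x - s * rnorm y) ^+ 2 / (s * t)).
  by rewrite divr_ge0 ?sqr_ge0// ltW.
by field; rewrite !gt_eqF.
Qed.

End HilbertIdentities.

Section DirectSum.
Variables (R : realType) (I : choiceType) (H : I -> hilbert R).

Definition partial_sqnorm (x : forall i, H i) (A : {fset I}) : R :=
  \sum_(i <- A) rnorm (x i) ^+ 2.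

(** Boundedness of the finite partial sums makes sense for index types of
arbitrary cardinality. *)
Definition square_summable (x : forall i, H i) : Prop :=
  exists M, forall A, partial_sqnorm x A <= M.

Record direct_sum := DirectSum {
  ds_fun :> forall i, H i;
  ds_summable : square_summable ds_fun }.

Lemma ds_ext (x y : direct_sum) : (forall i, x i = y i) -> x = y.
Proof.
case: x y => x hx [y hy] /= xy.
have e : x = y by exact: functional_extensionality_dep.
by subst y; congr DirectSum; exact: Prop_irrelevance.
Qed.

HB.instance Definition _ := gen_eqMixin direct_sum.
HB.instance Definition _ := gen_choiceMixin direct_sum.

Lemma partial_sqnormZ c x A :
  partial_sqnorm (fun i => c *: x i) A
  = complex.Re `|c| ^+ 2 * partial_sqnorm x A.
Proof.
rewrite /partial_sqnorm mulr_sumr.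
by apply: eq_bigr => i _; rewrite rnormZ exprMn.
Qed.

Lemma partial_sqnormD x y s t A : 0 < s -> 0 < t ->
  partial_sqnorm (fun i => x i + y i) A
  <= (1 + t / s) * partial_sqnorm x A + (1 + s / t) * partial_sqnorm y A.
Proof.
move=> s0 t0; rewrite /partial_sqnorm !mulr_sumr -big_split.
by apply: ler_sum => i _; exact: sqr_rnormD.
Qed.

Lemma square_summable0 : square_summable (fun=> 0).
Proof.
exists 0 => A; rewrite /partial_sqnorm big1// => i _.
by rewrite rnorm0 expr0n.
Qed.

Lemma square_summableZ c x : square_summable x ->
  square_summable (fun i => c *: x i).
Proof.
move=> [M hM]; exists (complex.Re `|c| ^+ 2 * M) => A.
by rewrite partial_sqnormZ ler_wpM2l// sqr_ge0.
Qed.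

Lemma square_summableD x y : square_summable x -> square_summable y ->
  square_summable (fun i => x i + y i).
Proof.
move=> [M hM] [N hN]; exists ((1 + 1 / 1) * M + (1 + 1 / 1) * N) => A.
apply: le_trans (partial_sqnormD x y A ltr01 ltr01) _.
by apply: lerD; apply: ler_wpM2l => //; rewrite divr1.
Qed.

Definition ds0 := DirectSum square_summable0.
Definition ds_add (x y : direct_sum) :=
  DirectSum (square_summableD (ds_summable x) (ds_summable y)).
Definition ds_scale c (x : direct_sum) :=
  DirectSum (square_summableZ c (ds_summable x)).
Definition ds_opp x := ds_scale (-1) x.

Let ds_addA : associative ds_add.
Proof. by move=> x y z; apply: ds_ext => i; exact: addrA. Qed.
Let ds_addC : commutative ds_add.
Proof. by move=> x y; apply: ds_ext => i; exact: addrC. Qed.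
Let ds_add0 : left_id ds0 ds_add.
Proof. by move=> x; apply: ds_ext => i; exact: add0r. Qed.
Let ds_addN : left_inverse ds0 ds_opp ds_add.
Proof. by move=> x; apply: ds_ext => i; rewrite /= scaleN1r addNr. Qed.
HB.instance Definition _ :=
  GRing.isZmodule.Build direct_sum ds_addA ds_addC ds_add0 ds_addN.

Let ds_scaleA a b x : ds_scale a (ds_scale b x) = ds_scale (a * b) x.
Proof. by apply: ds_ext => i; exact: scalerA. Qed.
Let ds_scale1 : left_id 1 ds_scale.
Proof. by move=> x; apply: ds_ext => i; exact: scale1r. Qed.
Let ds_scaleDr : right_distributive ds_scale +%R.
Proof. by move=> a x y; apply: ds_ext => i; exact: scalerDr. Qed.
Let ds_scaleDl x : {morph ds_scale^~ x : a b / a + b}.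
Proof. by move=> a b; apply: ds_ext => i; exact: scalerDl. Qed.
HB.instance Definition _ := GRing.Zmodule_isLmodule.Build R[i] direct_sum
  ds_scaleA ds_scale1 ds_scaleDr ds_scaleDl.

Lemma dsD (x y : direct_sum) i : (x + y) i = x i + y i.
Proof. by []. Qed.
Lemma dsN (x : direct_sum) i : (- x) i = - x i.
Proof. exact: scaleN1r. Qed.
Lemma dsB (x y : direct_sum) i : (x - y) i = x i - y i.
Proof. by rewrite dsD dsN. Qed.

Lemma ds_sum n (x : 'I_n -> direct_sum) i : (\sum_j x j) i = \sum_j x j i.
Proof. by elim/big_rec2: _ => // j a b _ <-. Qed.

Definition sqnorm (x : direct_sum) : R := sup (range (partial_sqnorm x)).

Lemma sqnorm_has_sup (x : direct_sum) : has_sup (range (partial_sqnorm x)).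
Proof.
split; first by exists (partial_sqnorm x fset0); exists fset0.
by have [M hM] := ds_summable x; exists M => _ [A _ <-].
Qed.

Lemma sqnorm_ub (x : direct_sum) A : partial_sqnorm x A <= sqnorm x.
Proof. by apply: sup_upper_bound; [exact: sqnorm_has_sup|exists A]. Qed.

Lemma sqnorm_le (x : direct_sum) M :
  (forall A, partial_sqnorm x A <= M) -> sqnorm x <= M.
Proof.
move=> hM; apply: ge_sup; first by case: (sqnorm_has_sup x).
by move=> _ [A _ <-].
Qed.

Lemma sqnorm_ge0 (x : direct_sum) : 0 <= sqnorm x.
Proof.
by apply: le_trans (sqnorm_ub x fset0); rewrite /partial_sqnorm big_nil.
Qed.

Lemma sqr_rnorm_coord (x : direct_sum) i : rnorm (x i) ^+ 2 <= sqnorm x.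
Proof.
apply: le_trans (sqnorm_ub x [fset i]%fset).
by rewrite /partial_sqnorm big_seq_fset1.
Qed.

Lemma partial_sqnorm_mono x (A B : {fset I}) : (A `<=` B)%fset ->
  partial_sqnorm x A <= partial_sqnorm x B.
Proof.
move=> AB; rewrite /partial_sqnorm [leRHS](big_fsetID _ (mem A)) /=.
rewrite (_ : [fset i in B | i \in A]%fset = A); last first.
  apply/fsetP => i; rewrite !inE andbC.
  by case: (boolP (i \in A)) => //= /(fsubsetP AB).
by rewrite lerDl sumr_ge0// => i _; rewrite sqr_ge0.
Qed.

Lemma sqnorm_cvg (x : direct_sum) : partial_sqnorm x @ totally --> sqnorm x.
Proof.
apply/cvgrPdist_lt => e e0.
have [_ [A _ <-] hA] := sup_adherent e0 (sqnorm_has_sup x).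
exists A => //= B AB.
rewrite ger0_norm ?subr_ge0 ?sqnorm_ub// ltrBlDr -ltrBlDl.
exact: lt_le_trans hA (partial_sqnorm_mono x AB).
Qed.

Lemma sqnormZ c x : sqnorm (c *: x) = complex.Re `|c| ^+ 2 * sqnorm x.
Proof.
apply: (@cvg_unique _ _ (partial_sqnorm (c *: x) @ totally)) => //.
  exact: sqnorm_cvg.
rewrite (_ : partial_sqnorm _ =
    fun A => complex.Re `|c| ^+ 2 * partial_sqnorm x A).
  by apply: cvgM; [exact: cvg_cst|exact: sqnorm_cvg].
by apply/funext => A; exact: partial_sqnormZ.
Qed.

Lemma sqnorm_eq0 x : sqnorm x = 0 -> x = 0.
Proof.
move=> x0; apply: ds_ext => i; apply: rnorm_eq0.
apply/eqP; rewrite -sqrf_eq0 eq_le sqr_ge0 andbT -x0.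
exact: sqr_rnorm_coord.
Qed.

Lemma sqnorm0 : sqnorm 0 = 0.
Proof. by rewrite -(scale0r (0 : direct_sum)) sqnormZ normr0 expr0n mul0r. Qed.

(** Summing the weighted bounds [sqr_rnormD] with the norms of [x] and [y] as
weights. *)
Lemma sqnormD (x y : direct_sum) :
  Num.sqrt (sqnorm (x + y)) <= Num.sqrt (sqnorm x) + Num.sqrt (sqnorm y).
Proof.
have [/sqnorm_eq0->|x0] := eqVneq (sqnorm x) 0.
  by rewrite add0r sqnorm0 sqrtr0 add0r.
have [/sqnorm_eq0->|y0] := eqVneq (sqnorm y) 0.
  by rewrite addr0 sqnorm0 sqrtr0 addr0.
have s0 : 0 < Num.sqrt (sqnorm x) by rewrite sqrtr_gt0 lt0r x0 sqnorm_ge0.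
have t0 : 0 < Num.sqrt (sqnorm y) by rewrite sqrtr_gt0 lt0r y0 sqnorm_ge0.
rewrite -[leRHS]ger0_norm ?addr_ge0 ?sqrtr_ge0// -sqrtr_sqr ler_wsqrtr//.
apply: sqnorm_le => A; apply: le_trans (partial_sqnormD x y A s0 t0) _.
set s := Num.sqrt (sqnorm x) in s0 *; set t := Num.sqrt (sqnorm y) in t0 *.
apply: (@le_trans _ _ ((1 + t / s) * sqnorm x + (1 + s / t) * sqnorm y)).
  by apply: lerD; apply: ler_wpM2l;
    rewrite ?sqnorm_ub// addr_ge0// divr_ge0// ltW.
rewrite le_eqVlt; apply/predU1P; left.
rewrite -[sqnorm x]sqr_sqrtr ?sqnorm_ge0// -[sqnorm y]sqr_sqrtr ?sqnorm_ge0//.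
by rewrite -/s -/t; field; rewrite !gt_eqF.
Qed.

Let ds_norm (x : direct_sum) : R[i] := (Num.sqrt (sqnorm x))%:C.

Let ds_normD x y : ds_norm (x + y) <= ds_norm x + ds_norm y.
Proof. by rewrite /ds_norm -rmorphD lecR; exact: sqnormD. Qed.

Let ds_normZ c x : ds_norm (c *: x) = `|c| * ds_norm x.
Proof.
rewrite /ds_norm sqnormZ sqrtrM ?sqr_ge0// sqrtr_sqr ger0_norm ?Re_normC_ge0//.
by rewrite real_complexM RRe_normC.
Qed.

Let ds_norm_eq0 x : ds_norm x = 0 -> x = 0.
Proof.
move=> [/eqP]; rewrite sqrtr_eq0 => x0; apply: sqnorm_eq0.
by apply/eqP; rewrite eq_le x0 sqnorm_ge0.
Qed.

HB.instance Definition _ :=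
  Lmodule_isNormed.Build R[i] direct_sum ds_normD ds_normZ ds_norm_eq0.

Lemma sqr_rnorm_ds (x : direct_sum) : rnorm x ^+ 2 = sqnorm x.
Proof. exact: (sqr_sqrtr (sqnorm_ge0 x)). Qed.

Lemma rnorm_coord (x : direct_sum) i : rnorm (x i) <= rnorm x.
Proof.
by rewrite -ler_sqr ?nnegrE ?rnorm_ge0// sqr_rnorm_ds sqr_rnorm_coord.
Qed.

End DirectSum.

Section DirectSumInner.
Variables (R : realType) (I : choiceType) (H : I -> hilbert R).
(* the type under which R[i] carries the topology of a number field *)
Local Notation C := (R[i] : numFieldType).
Local Notation ds := (direct_sum H).
Implicit Types x y z : ds.

Definition partial_inner x y (A : {fset I}) : C :=
  \sum_(i <- A) inner (H i) (x i) (y i).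

Definition ds_inner x y : C := lim (partial_inner x y @ totally).

Lemma partial_innerxx x A : partial_inner x x A = (partial_sqnorm x A)%:C.
Proof.
rewrite /partial_inner /partial_sqnorm rmorph_sum.
by apply: eq_bigr => i _; exact: inner_rnorm.
Qed.

Lemma partial_innerxx_cvg x :
  partial_inner x x @ totally --> ((sqnorm x)%:C : C).
Proof.
rewrite (_ : partial_inner x x = fun A => (partial_sqnorm x A)%:C).
  by apply: cvg_real_complex; exact: sqnorm_cvg.
by apply/funext => A; exact: partial_innerxx.
Qed.

Lemma partial_inner_is_cvg x y : cvg (partial_inner x y @ totally).
Proof.
pose P z := partial_inner z z.
have -> : partial_inner x y = fun A => 4^-1 * (P (x + y) A - P (x - y) A
    + 'i * (P (x + 'i *: y) A - P (x - 'i *: y) A)).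
  apply/funext => A; rewrite /P /partial_inner -!sumrB !mulr_sumr -big_split.
  rewrite mulr_sumr; apply: eq_bigr => i _.
  by rewrite polarization !dsB.
apply: is_cvgM; first exact: is_cvg_cst.
apply: is_cvgD.
  by apply: is_cvgB; apply: cvgP; exact: partial_innerxx_cvg.
apply: is_cvgM; first exact: is_cvg_cst.
by apply: is_cvgB; apply: cvgP; exact: partial_innerxx_cvg.
Qed.

Lemma ds_inner_cvg x y : partial_inner x y @ totally --> ds_inner x y.
Proof. exact: partial_inner_is_cvg. Qed.

Lemma ds_inner_unique x y l :
  partial_inner x y @ totally --> l -> ds_inner x y = l.
Proof. by move=> h; apply: cvg_lim. Qed.

Lemma ds_innerxx x : ds_inner x x = (sqnorm x)%:C.
Proof. by apply: ds_inner_unique; exact: partial_innerxx_cvg. Qed.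

Lemma ds_inner_herm x y : ds_inner x y = (ds_inner y x)^*.
Proof.
apply: ds_inner_unique.
rewrite (_ : partial_inner x y = fun A => (partial_inner y x A)^*).
  by apply: cvg_conjC; exact: ds_inner_cvg.
apply/funext => A; rewrite /partial_inner rmorph_sum; apply: eq_bigr => i _.
by rewrite hermC mul1r.
Qed.

Lemma ds_inner_linearl z : linear_for *%R (ds_inner ^~ z).
Proof.
move=> c x y /=; apply: ds_inner_unique.
rewrite (_ : partial_inner (c *: x + y) z
    = fun A => c * partial_inner x z A + partial_inner y z A).
  by apply: cvgD; [apply: cvgM; [exact: cvg_cst|]|]; exact: ds_inner_cvg.
apply/funext => A; rewrite /partial_inner mulr_sumr -big_split.
by apply: eq_bigr => i _; rewrite linearDl linearZl_LR.
Qed.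

Lemma ds_inner_linearr z : linear_for (Num.conj \; *%R) (ds_inner z).
Proof.
move=> c x y /=; rewrite (ds_inner_herm z (c *: x + y)) ds_inner_linearl.
by rewrite (ds_inner_herm z x) (ds_inner_herm z y) rmorphD rmorphM.
Qed.

HB.instance Definition _ := bilinear_isBilinear.Build R[i] ds ds R[i]
  *%R (Num.conj \; *%R) ds_inner (ds_inner_linearl, ds_inner_linearr).

Let ds_hermitian x y : ds_inner x y = (-1) ^+ false * (ds_inner y x)^*.
Proof. by rewrite mul1r -ds_inner_herm. Qed.
HB.instance Definition _ := isHermitianSesquilinear.Build R[i] ds
  false Num.conj ds_inner ds_hermitian.

Let ds_inner_gt0 x : x != 0 -> 0 < ds_inner x x.
Proof.
move=> x0; rewrite ds_innerxx ltcR lt0r sqnorm_ge0 andbT.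
by apply: contra_neq x0; exact: sqnorm_eq0.
Qed.
HB.instance Definition _ := isDotProduct.Build R[i] ds ds_inner ds_inner_gt0.

(** The limit is taken coordinatewise. A finite partial norm is continuous
for coordinatewise limits, so a bound on the distances within a small ball of
the filter passes to the distance from its center to the limit, uniformly in
the finite set of indices. *)
Lemma ds_complete (F : set_system ds) : ProperFilter F -> cauchy F -> cvg F.
Proof.
move=> FF /cauchyP Fc.
have center (e : R) : 0 < e -> exists x, \forall z \near F, rnorm (x - z) <= e.
  move=> e0; have [|x hx] := Fc e%:C; first by rewrite ltcR.
  exists x; apply: filterS hx => z; rewrite -ball_normE /ball_/= -rnormE ltcR.
  exact: ltW.
have coord_cvg i : cvg ((fun x : ds => x i) @ F).
  apply: cauchy_cvg; apply/cauchyP => _ /gt0_complexE[e e0 ->].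
  have [|x hx] := center (e / 2); first by rewrite divr_gt0.
  exists (x i); apply: filterS hx => z hz.
  rewrite -ball_normE /ball_/= -rnormE ltcR -dsB.
  apply: (le_lt_trans (rnorm_coord (x - z) i)).
  by apply: le_lt_trans hz _; rewrite ltr_pdivrMr// ltr_pMr// ltr1n.
pose y i := lim ((fun x : ds => x i) @ F).
have near_y (e : R) (x : ds) :
    0 < e -> (\forall z \near F, rnorm (x - z) <= e) ->
    forall A, partial_sqnorm (fun i => x i - y i) A <= e ^+ 2.
  move=> e0 hx A.
  have c : (fun z : ds => partial_sqnorm (x - z) A) @ F
      --> partial_sqnorm (fun i => x i - y i) A.
    rewrite /partial_sqnorm.
    apply: cvg_big => [|i _]; first exact: add_continuous.
    rewrite expr2 [X in X @ _](_ : _ =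
        fun z : ds => rnorm (x i - z i) * rnorm (x i - z i)).
      have c : (fun z : ds => rnorm (x i - z i)) @ F --> rnorm (x i - y i).
        by apply: cvg_rnorm; apply: cvgB; [exact: cvg_cst|exact: coord_cvg].
      exact: cvgM.
    by apply/funext => z; rewrite dsB.
  apply: (cvgr_to_le c); apply: filterS hx => z hz.
  apply: le_trans (sqnorm_ub _ _) _.
  by rewrite -sqr_rnorm_ds ler_sqr ?nnegrE ?rnorm_ge0// ltW.
have [x hx] := center 1 ltr01.
(* [y] itself is square summable, being the difference of [x] and [x - y] *)
pose w := DirectSum (ex_intro _ _ (near_y _ _ ltr01 hx)).
have wE i : (x - w) i = y i by rewrite dsB subKr.
apply/cvg_ex; exists (x - w); apply/cvg_rnormP => e e0.
have [|t ht] := center (e / 2); first by rewrite divr_gt0.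
apply: filterS (ht) => z hz.
rewrite (_ : x - w - z = (t - z) - (t - (x - w))); last first.
  by rewrite opprB [RHS]addrC addrA subrK.
have e2 : 0 < e / 2 by rewrite divr_gt0.
rewrite [leRHS]splitr; apply: le_trans (rnormD _ _) _; apply: lerD => //.
rewrite rnormN -ler_sqr ?nnegrE ?rnorm_ge0 ?(ltW e2)// sqr_rnorm_ds.
apply: sqnorm_le => A; apply: le_trans (near_y _ _ e2 ht A).
by rewrite le_eqVlt; apply/predU1P; left; apply: eq_bigr => i _; rewrite dsB wE.
Qed.

HB.instance Definition _ := Uniform_isComplete.Build ds ds_complete.

Lemma sqr_norm_ds_inner x : `|x| ^+ 2 = ds_inner x x.
Proof. by rewrite ds_innerxx -sqr_rnorm_ds -rnormE !expr2 real_complexM. Qed.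

Definition hilbert_sum : hilbert R :=
  @Hilbert R (ds : completeNormedModType R[i])
    (ds_inner : {dot ds for Num.conj}) sqr_norm_ds_inner.

End DirectSumInner.

(** * Bounded operators *)

Section BopTheory.
Variables (R : realType) (H : hilbert R).

Lemma bounded_operatorP (T : H -> H) (M : R) : linear T ->
  (forall x, rnorm (T x) <= M * rnorm x) -> T \in @bounded_operator R H.
Proof.
move=> Tlin hM; apply/asboolP; split=> // x.
have TB y : T (x - y) = T x - T y.
  by rewrite -scaleN1r addrC Tlin scaleN1r addrC.
apply/cvg_rnormP => e e0.
have M0 : 0 < `|M| + 1 by rewrite ltr_wpDl.
have /cvg_rnormP/(_ (e / (`|M| + 1))) : id @ x --> x by exact: cvg_id.
rewrite divr_gt0// => /(_ isT); apply: filterS => y xy.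
rewrite -TB; apply: le_trans (hM _) _.
apply: (@le_trans _ _ ((`|M| + 1) * rnorm (x - y))).
  by rewrite ler_wpM2r ?rnorm_ge0// (le_trans (ler_norm M))// lerDl.
by rewrite mulrC -ler_pdivlMr.
Qed.

Lemma opnorm_lef (T : bop H) M : 0 <= M ->
  (forall x, rnorm (T x) <= M * rnorm x) -> opnorm T <= M.
Proof.
move=> M0 hM; apply: opnorm_le => x x1; apply: le_trans (hM x) _.
by rewrite -[leRHS]mulr1 ler_wpM2l.
Qed.

Lemma opnorm0 : opnorm (0 : bop H) = 0.
Proof. exact: (rnorm0 (bop H)). Qed.

Lemma opnorm_leD (S T : bop H) : opnorm (S + T) <= opnorm S + opnorm T.
Proof. exact: (@rnormD _ (bop H)). Qed.

Lemma opnormN (T : bop H) : opnorm (- T) = opnorm T.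
Proof. exact: (@rnormN _ (bop H)). Qed.

Lemma opnorm_distC (S T : bop H) : opnorm (S - T) = opnorm (T - S).
Proof. exact: (@rnorm_distC _ (bop H)). Qed.

Lemma opnorm_scale c (T : bop H) : opnorm (c *: T) = complex.Re `|c| * opnorm T.
Proof. exact: (@rnormZ _ (bop H)). Qed.

Lemma opnormM (S T : bop H) : opnorm (S * T) <= opnorm S * opnorm T.
Proof.
apply: opnorm_lef => [|x]; first by rewrite mulr_ge0 ?opnorm_ge0.
apply: le_trans (opnormP S (T x)) _.
by rewrite -mulrA ler_wpM2l ?opnorm_ge0// opnormP.
Qed.

Lemma bopBE (S T : bop H) x : (S - T) x = S x - T x. Proof. by []. Qed.
Lemma bopME (S T : bop H) x : (S * T) x = S (T x). Proof. by []. Qed.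

Lemma opnormMB (S T S' T' : bop H) (e : R) :
  e <= 1 -> opnorm (S - S') <= e -> opnorm (T - T') <= e ->
  opnorm (S * T - S' * T') <= (opnorm S + opnorm T + 1) * e.
Proof.
move=> e1 hS hT.
have e0 : 0 <= e := le_trans (opnorm_ge0 _) hS.
have hT' : opnorm T' <= opnorm T + 1.
  have := opnorm_leD (T' - T) T; rewrite subrK opnorm_distC => /le_trans; apply.
  by rewrite addrC lerD2l; exact: le_trans hT e1.
rewrite (_ : _ - _ = S * (T - T') + (S - S') * T'); last first.
  by rewrite mulrBr mulrBl addrA subrK.
apply: le_trans (opnorm_leD _ _) _.
rewrite -[X in X * e]addrA [leRHS]mulrDl; apply: lerD.
  by apply: le_trans (opnormM _ _) _; rewrite ler_wpM2l ?opnorm_ge0.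
apply: le_trans (opnormM _ _) _; rewrite mulrC.
by apply: ler_pM => //; exact: opnorm_ge0.
Qed.

Lemma bop_ext (S T : bop H) : (forall x, S x = T x) -> S = T.
Proof. by move=> ST; apply/val_inj/funext. Qed.

Lemma opnormZDB c (S T S' T' : bop H) e :
  opnorm (S - S') <= e -> opnorm (T - T') <= e ->
  opnorm ((c *: S + T) - (c *: S' + T')) <= (complex.Re `|c| + 1) * e.
Proof.
move=> hS hT; rewrite opprD addrACA -scalerBr mulrDl mul1r.
apply: le_trans (opnorm_leD _ _) _.
by apply: lerD => //; rewrite opnorm_scale ler_wpM2l// Re_normC_ge0.
Qed.

(** The limit is taken pointwise; the bounds on the distances within a small
ball of the filter pass to the limit vector by vector, which gives at once the
boundedness of the limit and the convergence in operator norm. *)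
Lemma bop_complete (F : set_system (bop H)) :
  ProperFilter F -> cauchy F -> cvg F.
Proof.
move=> FF /cauchyP Fc.
have center (e : R) : 0 < e ->
    exists S : bop H, \forall T \near F, opnorm (S - T) <= e.
  move=> e0; have [|S hS] := Fc e%:C; first by rewrite ltcR.
  exists S; apply: filterS hS => T; rewrite -ball_normE /ball_/= -rnormE ltcR.
  exact: ltW.
have pt_cvg x : cvg ((fun T : bop H => T x) @ F).
  apply: cauchy_cvg; apply/cauchyP => _ /gt0_complexE[e e0 ->].
  have x1 : 0 < rnorm x + 1 by rewrite ltr_wpDl// rnorm_ge0.
  have [|S hS] := center (e / (rnorm x + 1)); first by rewrite divr_gt0.
  exists (S x); apply: filterS hS => T hT.
  rewrite -ball_normE /ball_/= -rnormE ltcR -bopBE.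
  apply: (le_lt_trans (opnormP (S - T) x)).
  apply: (@le_lt_trans _ _ (e / (rnorm x + 1) * rnorm x)).
    by rewrite ler_wpM2r ?rnorm_ge0.
  by rewrite mulrAC ltr_pdivrMr// ltr_pM2l// ltrDl.
pose L x := lim ((fun T : bop H => T x) @ F).
have Llin : linear L.
  move=> c x y; apply: cvg_lim => //.
  rewrite (_ : (fun T : bop H => T (c *: x + y)) = fun T => c *: T x + T y).
    by apply: cvgD; [apply: cvgZr|]; exact: pt_cvg.
  by apply/funext => T; rewrite linearP.
have near_L (e : R) (S : bop H) : (\forall T \near F, opnorm (S - T) <= e) ->
    forall x, rnorm (S x - L x) <= e * rnorm x.
  move=> hS x.
  have c : (fun T : bop H => rnorm (S x - T x)) @ F --> rnorm (S x - L x).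
    by apply: cvg_rnorm; apply: cvgB; [exact: cvg_cst|exact: pt_cvg].
  apply: (cvgr_to_le c); apply: filterS hS => T hT.
  rewrite -bopBE; apply: le_trans (opnormP _ _) _.
  by rewrite ler_wpM2r ?rnorm_ge0.
have [S hS] := center 1 ltr01.
have Lb : L \in @bounded_operator R H.
  apply: (@bounded_operatorP _ (opnorm S + 1)) => // x.
  rewrite -(subKr (S x) (L x)) mulrDl; apply: le_trans (rnormD _ _) _.
  by rewrite rnormN lerD ?opnormP ?near_L.
apply/cvg_ex; exists (Bop Lb); apply/cvg_rnormP => e e0.
have e2 : 0 < e / 2 by rewrite divr_gt0.
have [T hT] := center (e / 2) e2.
apply: filterS (hT) => U hU.
rewrite (_ : Bop Lb - U = (T - U) - (T - Bop Lb)); last first.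
  by rewrite opprB [RHS]addrC addrA subrK.
rewrite [leRHS]splitr; apply: le_trans (rnormD _ _) _; apply: lerD => //.
by rewrite rnormN; apply: opnorm_lef (ltW e2) _ => x; exact: near_L.
Qed.

HB.instance Definition _ := Uniform_isComplete.Build (bop H) bop_complete.

End BopTheory.

(** * Matrices of operators *)

Section ColumnNorm.
Variables (R : realType) (H : hilbert R).

Lemma l2norm_ge0 n (x : 'I_n -> H) : 0 <= l2norm x.
Proof. exact: sqrtr_ge0. Qed.

Lemma sqr_l2norm n (x : 'I_n -> H) : l2norm x ^+ 2 = \sum_j rnorm (x j) ^+ 2.
Proof. by rewrite sqr_sqrtr// sumr_ge0// => j _; rewrite sqr_ge0. Qed.

Lemma l2norm_ler (H' : hilbert R) m n (x : 'I_n -> H) (y : 'I_m -> H') :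
  \sum_j rnorm (x j) ^+ 2 <= \sum_j rnorm (y j) ^+ 2 -> l2norm x <= l2norm y.
Proof. exact: ler_wsqrtr. Qed.

Lemma l2normZ n c (x : 'I_n -> H) :
  l2norm (fun j => c *: x j) = complex.Re `|c| * l2norm x.
Proof.
rewrite /l2norm -[X in X * _]ger0_norm ?Re_normC_ge0// -sqrtr_sqr.
rewrite -sqrtrM ?sqr_ge0// mulr_sumr; congr Num.sqrt.
by apply: eq_bigr => j _; rewrite rnormZ exprMn.
Qed.

Lemma l2norm0 n : l2norm (fun _ : 'I_n => 0 : H) = 0.
Proof.
by rewrite /l2norm big1 ?sqrtr0// => j _; rewrite rnorm0 expr0n.
Qed.

Lemma rnorm_l2norm n (x : 'I_n -> H) j : rnorm (x j) <= l2norm x.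
Proof.
rewrite -ler_sqr ?nnegrE ?rnorm_ge0 ?l2norm_ge0// sqr_l2norm (bigD1 j)//=.
by rewrite lerDl sumr_ge0// => k _; rewrite sqr_ge0.
Qed.

End ColumnNorm.

Section MatrixNorm.
Variables (R : realType) (H : hilbert R).

Lemma partial_sqnorm_ord n (x : 'I_n -> H) (A : {fset 'I_n}) :
  partial_sqnorm (H := fun=> H) x A <= \sum_j rnorm (x j) ^+ 2.
Proof.
rewrite /partial_sqnorm big_uniq ?fset_uniq//= [leLHS]big_mkcond/=.
by apply: ler_sum => j _; case: ifP => // _; rewrite sqr_ge0.
Qed.

(** The identification of H^n with a direct sum, through which [l2norm]
inherits the triangle inequality. *)
Definition vec n (x : 'I_n -> H) : direct_sum (fun _ : 'I_n => H) :=
  DirectSum (ex_intro _ _ (partial_sqnorm_ord x)).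

Lemma rnorm_vec n (x : 'I_n -> H) : rnorm (vec x) = l2norm x.
Proof.
rewrite -[LHS]ger0_norm ?rnorm_ge0// -sqrtr_sqr sqr_rnorm_ds; congr Num.sqrt.
apply/eqP; rewrite eq_le; apply/andP; split.
  by apply: sqnorm_le; exact: partial_sqnorm_ord.
apply: le_trans (sqnorm_ub _ [fset j | j in 'I_n]%fset).
rewrite /partial_sqnorm [leRHS]big_uniq ?fset_uniq//= le_eqVlt.
by apply/predU1P; left; apply: eq_bigl => j; rewrite !inE.
Qed.

Lemma l2normD n (x y : 'I_n -> H) :
  l2norm (fun j => x j + y j) <= l2norm x + l2norm y.
Proof.
rewrite -!rnorm_vec; apply: le_trans (rnormD _ _).
by rewrite le_eqVlt; apply/predU1P; left; congr rnorm; exact: ds_ext.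
Qed.

Lemma l2norm_le_sum n (x : 'I_n -> H) : l2norm x <= \sum_j rnorm (x j).
Proof.
rewrite -[leRHS]ger0_norm ?sumr_ge0//; last by move=> j _; exact: rnorm_ge0.
rewrite -sqrtr_sqr ler_wsqrtr// expr2 mulr_suml; apply: ler_sum => j _.
rewrite expr2 ler_wpM2l ?rnorm_ge0// (bigD1 j)//= lerDl sumr_ge0// => k _.
exact: rnorm_ge0.
Qed.

Lemma mx_act_bounded m n (T : 'M[bop H]_(m, n)) (x : 'I_n -> H) :
  l2norm (mx_act T x) <= (\sum_i \sum_j opnorm (T i j)) * l2norm x.
Proof.
apply: le_trans (l2norm_le_sum _) _; rewrite mulr_suml; apply: ler_sum => i _.
apply: le_trans (rnorm_sum _) _; rewrite mulr_suml; apply: ler_sum => j _.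
apply: le_trans (opnormP _ _) _.
by rewrite ler_wpM2l ?opnorm_ge0// rnorm_l2norm.
Qed.

Lemma mxnorm_has_sup m n (T : 'M[bop H]_(m, n)) :
  has_sup [set l2norm (mx_act T x) | x in [set x : 'I_n -> H | l2norm x <= 1]].
Proof.
split.
  exists (l2norm (mx_act T (fun=> 0))); exists (fun=> 0) => //=.
  by rewrite l2norm0.
exists (\sum_i \sum_j opnorm (T i j)) => _ [y y1 <-].
apply: le_trans (mx_act_bounded T y) _; rewrite -[leRHS]mulr1 ler_wpM2l//.
by apply: sumr_ge0 => i _; apply: sumr_ge0 => j _; exact: opnorm_ge0.
Qed.

Lemma mxnorm_le m n (T : 'M[bop H]_(m, n)) M : 0 <= M ->
  (forall x, l2norm (mx_act T x) <= M * l2norm x) -> mxnorm T <= M.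
Proof.
move=> M0 hM; apply: ge_sup; first by case: (mxnorm_has_sup T).
move=> _ [x x1 <-]; apply: le_trans (hM x) _.
by rewrite -[leRHS]mulr1 ler_wpM2l.
Qed.

Lemma mx_actZ m n (T : 'M[bop H]_(m, n)) c (x : 'I_n -> H) :
  mx_act T (fun j => c *: x j) = fun i => c *: mx_act T x i.
Proof.
apply/funext => i; rewrite /mx_act scaler_sumr.
by apply: eq_bigr => j _; rewrite linearZ.
Qed.

Lemma mxnormP m n (T : 'M[bop H]_(m, n)) (x : 'I_n -> H) :
  l2norm (mx_act T x) <= mxnorm T * l2norm x.
Proof.
have [x0|x0] := eqVneq (l2norm x) 0.
  by apply: le_trans (mx_act_bounded T x) _; rewrite x0 !mulr0.
have {}x0 : 0 < l2norm x by rewrite lt0r x0 l2norm_ge0.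
have cE : complex.Re `|(l2norm x)^-1%:C : R[i]| = (l2norm x)^-1.
  by rewrite ger0_norm// lecR invr_ge0 ltW.
rewrite -ler_pdivrMr// mulrC -{1}cE -l2normZ -mx_actZ.
apply: sup_upper_bound; first exact: mxnorm_has_sup.
exists (fun j => (l2norm x)^-1%:C *: x j) => //=.
by rewrite l2normZ cE mulVf// gt_eqF.
Qed.

Lemma mxnorm_ge0 m n (T : 'M[bop H]_(m, n)) : 0 <= mxnorm T.
Proof.
apply: le_trans (l2norm_ge0 (mx_act T (fun=> 0))) _.
apply: sup_upper_bound; first exact: mxnorm_has_sup.
by exists (fun=> 0) => //=; rewrite l2norm0.
Qed.

Lemma mxnormD m n (S T : 'M[bop H]_(m, n)) :
  mxnorm (S + T) <= mxnorm S + mxnorm T.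
Proof.
apply: mxnorm_le => [|x]; first by rewrite addr_ge0 ?mxnorm_ge0.
rewrite mulrDl (_ : mx_act (S + T) x = fun i => mx_act S x i + mx_act T x i).
  by apply: le_trans (l2normD _ _) _; apply: lerD; exact: mxnormP.
apply/funext => i; rewrite /mx_act -big_split; apply: eq_bigr => j _.
by rewrite mxE.
Qed.

Lemma mxnorm_le_sum m n (T : 'M[bop H]_(m, n)) :
  mxnorm T <= \sum_i \sum_j opnorm (T i j).
Proof.
apply: mxnorm_le (mx_act_bounded T).
by apply: sumr_ge0 => i _; apply: sumr_ge0 => j _; exact: opnorm_ge0.
Qed.

(** Through this bound, estimates for matrix norms pass to entrywise limits. *)
Lemma mxnorm_dist m n (S T : 'M[bop H]_(m, n)) e :
  (forall i j, opnorm (S i j - T i j) <= e) ->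
  mxnorm S <= mxnorm T + (e *+ n) *+ m.
Proof.
move=> he; rewrite -[S](subrK T) addrC.
apply: le_trans (mxnormD _ _) _; rewrite lerD2l.
apply: le_trans (mxnorm_le_sum _) _.
have -> : (e *+ n) *+ m = \sum_(i < m) \sum_(j < n) e.
  by rewrite !sumr_const !card_ord.
apply: ler_sum => i _; apply: ler_sum => j _.
by rewrite !mxE he.
Qed.

Lemma mxnorm1 (T : bop H) : mxnorm (const_mx T : 'M[bop H]_1) = opnorm T.
Proof.
have l1 (x : 'I_1 -> H) : l2norm x = rnorm (x ord0).
  by rewrite /l2norm big_ord1 sqrtr_sqr ger0_norm ?rnorm_ge0.
have act1 (x : 'I_1 -> H) :
    mx_act (const_mx T : 'M[bop H]_1) x ord0 = T (x ord0).
  by rewrite /mx_act big_ord1 mxE.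
apply/eqP; rewrite eq_le; apply/andP; split.
  by apply: mxnorm_le (opnorm_ge0 T) _ => x; rewrite !l1 act1 opnormP.
apply: opnorm_lef (mxnorm_ge0 _) _ => x.
by have := mxnormP (const_mx T : 'M[bop H]_1) (fun=> x); rewrite !l1 act1.
Qed.

End MatrixNorm.

(** * Diagonal operators on direct sums *)

Section Diagonal.
Variables (R : realType) (I : choiceType) (H : I -> hilbert R).
Local Notation HS := (hilbert_sum H).
Variable T : forall i, bop (H i).
Hypothesis T_contr : forall i x, rnorm (T i x) <= rnorm x.

Lemma partial_sqnorm_diag (x : direct_sum H) A :
  partial_sqnorm (fun i => T i (x i)) A <= partial_sqnorm x A.
Proof.
by apply: ler_sum => i _; rewrite ler_sqr ?nnegrE ?rnorm_ge0.
Qed.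

Lemma square_summable_diag (x : direct_sum H) :
  square_summable (fun i => T i (x i)).
Proof.
have [M hM] := ds_summable x; exists M => A.
exact: le_trans (partial_sqnorm_diag x A) (hM A).
Qed.

Definition diag_fun (x : HS) : HS := DirectSum (square_summable_diag x).

Lemma diag_bounded : diag_fun \in @bounded_operator R HS.
Proof.
apply: (@bounded_operatorP _ _ _ 1) => [c x y|x].
  by apply: ds_ext => i /=; rewrite linearP.
rewrite mul1r -ler_sqr ?nnegrE ?rnorm_ge0// !sqr_rnorm_ds.
apply: sqnorm_le => A; apply: le_trans (sqnorm_ub x A).
exact: partial_sqnorm_diag.
Qed.

Definition diag : bop HS := Bop diag_bounded.

End Diagonal.

Section Embedding.
Variables (R : realType) (I : choiceType) (H : I -> hilbert R).

Definition single i (v : H i) : forall k, H k :=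
  @dfwith I (fun k => H k : Type) (fun=> 0) i v.

Lemma single_in i (v : H i) : single v i = v.
Proof. exact: dfwith_in. Qed.

Lemma single_out i (v : H i) k : i != k -> single v k = 0.
Proof. exact: (@dfwith_out I (fun k => H k : Type) (fun=> 0) i v k). Qed.

Lemma rnorm_embed_subproof i (v : H i) (A : {fset I}) :
  partial_sqnorm (single v) A <= rnorm v ^+ 2.
Proof.
apply: (@le_trans _ _ (partial_sqnorm (single v) (i |` A)%fset)).
  by apply: partial_sqnorm_mono; exact: fsubsetU1.
rewrite /partial_sqnorm (big_fsetD1 i) ?fset1U1//= single_in.
rewrite big_seq big1 ?addr0// => k; rewrite !inE => /andP[ki _].
by rewrite single_out ?rnorm0 ?expr0n// eq_sym.
Qed.

Definition embed i (v : H i) : hilbert_sum H :=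
  DirectSum (ex_intro _ _ (rnorm_embed_subproof v)).

Lemma rnorm_embed i (v : H i) : rnorm (embed v) <= rnorm v.
Proof.
rewrite -ler_sqr ?nnegrE ?rnorm_ge0// sqr_rnorm_ds.
by apply: sqnorm_le; exact: rnorm_embed_subproof.
Qed.

Lemma embed_in i (v : H i) : (embed v : direct_sum H) i = v.
Proof. exact: single_in. Qed.

End Embedding.

(** * Noncommutative polynomials and their extension to closed algebras *)

(** Syntactic noncommutative polynomials with zero constant term, since the
generated algebras need not contain the identity. Distinct expressions may
denote the same polynomial; only their values at representations matter. *)
Inductive nc_poly (R : realType) (X : Type) : Type :=
  | NCVar of X
  | NCZero
  | NCLin of R[i] & nc_poly R X & nc_poly R X
  | NCMul of nc_poly R X & nc_poly R X.
Arguments NCZero {R X}.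
Arguments NCVar {R X}.

Fixpoint nc_eval (R : realType) (X : Type) (H : hilbert R) (pi : X -> bop H)
    (p : nc_poly R X) : bop H :=
  match p with
  | NCVar x => pi x
  | NCZero => 0
  | NCLin c p q => c *: nc_eval pi p + nc_eval pi q
  | NCMul p q => nc_eval pi p * nc_eval pi q
  end.

Section ClosedSubalgebra.
Variables (R : realType) (H : hilbert R).

Lemma smallest_closed_subalgebra (B : set (bop H)) :
  closed_subalgebra (smallest (@closed_subalgebra R H) B).
Proof.
split=> [A [[]]//|c S T hS hT A hA|S T hS hT A hA|].
- by case: (hA) => -[_ lin _ _] _; apply: lin; [exact: hS|exact: hT].
- by case: (hA) => -[_ _ mul _] _; apply: mul; [exact: hS|exact: hT].
by apply: closed_bigI => A [[]].
Qed.

Lemma smallest_subalgebra_ind (B P : set (bop H)) :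
  closed_subalgebra P -> B `<=` P -> smallest (@closed_subalgebra R H) B `<=` P.
Proof. by move=> cP BP; apply: smallest_sub. Qed.

Lemma closed_subalgebra_rnorm (P : set (bop H)) :
  P 0 -> (forall (c : R[i]) S T, P S -> P T -> P (c *: S + T)) ->
  (forall S T, P S -> P T -> P (S * T)) ->
  (forall T, (forall e : R, 0 < e -> exists2 S, P S & opnorm (T - S) <= e) ->
     P T) ->
  closed_subalgebra P.
Proof. by move=> P0 Pl Pm Pc; split=> //; apply/closed_rnormP. Qed.

End ClosedSubalgebra.

Definition generated_algebra (R : realType) (X : Type) (K : hilbert R)
    (iota : X -> bop K) : operator_algebra R :=
  OperatorAlgebra (smallest_closed_subalgebra (range iota)).

Lemma generated_algebra_gen (R : realType) (X : Type) (K : hilbert R)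
    (iota : X -> bop K) x : oa_set (generated_algebra iota) (iota x).
Proof. by move=> B [_]; apply; exists x. Qed.

Section Extension.
Variables (R : realType) (X : Type) (K H : hilbert R).
Variables (iota : X -> bop K) (pi : X -> bop H).
Hypothesis dominated : forall n (p : 'M[nc_poly R X]_n),
  mxnorm (map_mx (nc_eval pi) p) <= mxnorm (map_mx (nc_eval iota) p).

Local Notation A := (generated_algebra iota).

Lemma nc_eval_dist p q :
  opnorm (nc_eval pi p - nc_eval pi q)
  <= opnorm (nc_eval iota p - nc_eval iota q).
Proof.
have E (L : hilbert R) (rho : X -> bop L) :
    nc_eval rho p - nc_eval rho q = nc_eval rho (NCLin (-1) q p).
  by rewrite /= scaleN1r addrC.
rewrite !E -!mxnorm1.
have := dominated (const_mx (NCLin (-1) q p) : 'M[nc_poly R X]_1).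
by rewrite !map_const_mx.
Qed.

(** The closure of the set of pairs (p(iota), p(pi)), which is the graph of the
extension of p(iota) |-> p(pi) to the closed algebra generated by [iota]. *)
Definition is_ext T S := forall e : R, 0 < e -> exists p,
  opnorm (T - nc_eval iota p) <= e /\ opnorm (S - nc_eval pi p) <= e.

Lemma is_ext_nc_eval p : is_ext (nc_eval iota p) (nc_eval pi p).
Proof.
by move=> e e0; exists p; rewrite !subrr !opnorm0 ltW.
Qed.

(** The domination of matrix norms survives entrywise limits. *)
Lemma is_ext_mx n (T : 'M[bop K]_n) (S : 'M[bop H]_n) :
  (forall i j, is_ext (T i j) (S i j)) -> mxnorm S <= mxnorm T.
Proof.
move=> TS; apply/ler_addgt0Pl => e e0; rewrite addrC.
(* two approximations by d in each of n^2 entries cost 2 n^2 d <= e *)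
pose d := e / (n%:R * n%:R + 1) / 2.
have nn : 0 < n%:R * n%:R + 1 :> R by rewrite ltr_wpDl// mulr_ge0.
have d0 : 0 < d by rewrite !divr_gt0.
have /choice[p hp] : forall ij : 'I_n * 'I_n, exists p,
    opnorm (T ij.1 ij.2 - nc_eval iota p) <= d
    /\ opnorm (S ij.1 ij.2 - nc_eval pi p) <= d.
  by move=> ij; exact: TS.
pose P := \matrix_(i, j) p (i, j).
have hS : mxnorm S <= mxnorm (map_mx (nc_eval pi) P) + (d *+ n) *+ n.
  by apply: mxnorm_dist => i j; rewrite !mxE; case: (hp (i, j)).
have hT : mxnorm (map_mx (nc_eval iota) P) <= mxnorm T + (d *+ n) *+ n.
  apply: mxnorm_dist => i j; rewrite !mxE.
  by rewrite opnorm_distC; case: (hp (i, j)).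
have dn : (d *+ n) *+ n + (d *+ n) *+ n <= e.
  rewrite -mulrnA -mulrnDr -mulr_natr natrD natrM.
  rewrite (_ : d * _ = e * (n%:R * n%:R) / (n%:R * n%:R + 1)); last first.
    by rewrite /d; field; rewrite gt_eqF.
  by rewrite ler_pdivrMr// ler_pM2l// lerDl.
apply: (le_trans hS).
apply: (@le_trans _ _ (mxnorm T + (d *+ n) *+ n + (d *+ n) *+ n)).
  by rewrite lerD2r; exact: le_trans (dominated P) hT.
by rewrite -addrA lerD2l.
Qed.

Lemma is_ext_unique T S S' : is_ext T S -> is_ext T S' -> S = S'.
Proof.
move=> TS TS'; apply/eqP; rewrite -subr_eq0; apply/eqP.
apply: (@rnorm_le0P _ (bop H)) => e e0; rewrite -/(opnorm _).
have e4 : 0 < e / 2 / 2 by rewrite !divr_gt0.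
have [p [Tp Sp]] := TS _ e4; have [q [Tq Sq]] := TS' _ e4.
rewrite (_ : S - S' = (S - nc_eval pi p) - (S' - nc_eval pi q)
    + (nc_eval pi p - nc_eval pi q)); last first.
  by rewrite opprB [RHS]addrAC !subrKA.
rewrite [leRHS]splitr; apply: le_trans (opnorm_leD _ _) _; apply: lerD.
  rewrite [leRHS]splitr; apply: le_trans (opnorm_leD _ _) _.
  by rewrite opnormN; apply: lerD.
apply: le_trans (nc_eval_dist p q) _.
rewrite -(subrKA T) [leRHS]splitr; apply: le_trans (opnorm_leD _ _) _.
by apply: lerD => //; rewrite opnorm_distC.
Qed.

Lemma is_ext_lin c T S T' S' :
  is_ext T S -> is_ext T' S' -> is_ext (c *: T + T') (c *: S + S').
Proof.
move=> TS TS' e e0; pose M := complex.Re `|c| + 1.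
have M0 : 0 < M by rewrite ltr_wpDl// Re_normC_ge0.
have d0 : 0 < e / M by rewrite divr_gt0.
have [p [Tp Sp]] := TS _ d0; have [q [Tq Sq]] := TS' _ d0.
have eE : e = M * (e / M) by rewrite mulrC divfK// gt_eqF.
by exists (NCLin c p q); rewrite eE; split; exact: opnormZDB.
Qed.

Lemma is_ext_mul T S T' S' :
  is_ext T S -> is_ext T' S' -> is_ext (T * T') (S * S').
Proof.
move=> TS TS' e e0.
pose M := (opnorm T + opnorm T' + 1) + (opnorm S + opnorm S' + 1).
have M1 : 0 <= opnorm T + opnorm T' + 1 by rewrite !addr_ge0 ?opnorm_ge0.
have M2 : 0 < opnorm S + opnorm S' + 1.
  by rewrite ltr_wpDl// addr_ge0 ?opnorm_ge0.
have M0 : 0 < M by rewrite ltr_wpDl.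
pose d := Num.min 1 (e / M).
have d0 : 0 < d by rewrite lt_min ltr01 divr_gt0.
have d1 : d <= 1 by rewrite ge_min lexx.
have dM : M * d <= e by rewrite -ler_pdivlMl// mulrC ge_min lexx orbT.
have [p [Tp Sp]] := TS _ d0; have [q [Tq Sq]] := TS' _ d0.
exists (NCMul p q); split; apply: le_trans (opnormMB d1 _ _) _ => //;
  apply: le_trans dM; rewrite ler_wpM2r ?(ltW d0)//.
  by rewrite lerDl ltW.
by rewrite lerDr.
Qed.

(** Polynomials whose values at [iota] tend to [T] have Cauchy values at [pi],
by domination, and B(H) is complete. *)
Lemma is_ext_approx T :
  (forall e : R, 0 < e -> exists p, opnorm (T - nc_eval iota p) <= e) ->
  exists S, is_ext T S.
Proof.
move=> hT.
pose G := filter_from (fun e : R => 0 < e)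
  (fun e => [set p | opnorm (T - nc_eval iota p) <= e]).
have GF : ProperFilter G.
  apply: filter_from_proper; last by move=> e e0; exact: hT.
  apply: filter_from_filter; first by exists 1; exact: ltr01.
  move=> d e d0 e0; exists (Num.min d e); first by rewrite lt_min d0 e0.
  by move=> p /=; rewrite le_min => /andP.
have Gc : cauchy (nc_eval pi @ G).
  apply/cauchyP => _ /gt0_complexE[e e0 ->].
  have e4 : 0 < e / 2 / 2 by rewrite !divr_gt0.
  have [p hp] := hT _ e4; exists (nc_eval pi p).
  exists (e / 2 / 2) => // q /= hq; rewrite -ball_normE /ball_/= -rnormE ltcR.
  apply: (le_lt_trans (nc_eval_dist p q)); apply: (@le_lt_trans _ _ (e / 2)).
    rewrite -(subrKA T) [leRHS]splitr; apply: le_trans (opnorm_leD _ _) _.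
    by apply: lerD => //; rewrite opnorm_distC.
  by rewrite ltr_pdivrMr// ltr_pMr// ltr1n.
have /cvg_ex[S /cvg_rnormP GS] : cvg (nc_eval pi @ G) by exact: cauchy_cvg.
exists S => e e0.
have Ge : G [set p | opnorm (T - nc_eval iota p) <= e] by exists e.
by have [p [Sp Tp]] := filter_ex (filterI (GS e e0) Ge); exists p.
Qed.

(** The operators with an extension form a closed subalgebra: sums, products
and limits of approximations by polynomials are approximated by polynomials. *)
Lemma is_ext_exists T : oa_set A T -> exists S, is_ext T S.
Proof.
pose P := [set T | exists S, is_ext T S].
apply: (@smallest_subalgebra_ind _ _ _ P); last first.
  by move=> _ [x _ <-]; exists (pi x); exact: (is_ext_nc_eval (NCVar x)).
apply: closed_subalgebra_rnorm.
- by exists 0; exact: (is_ext_nc_eval NCZero).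
- by move=> c U V [U' hU] [V' hV]; exists (c *: U' + V'); exact: is_ext_lin.
- by move=> U V [U' hU] [V' hV]; exists (U' * V'); exact: is_ext_mul.
move=> U hU; apply: is_ext_approx => e e0.
have e2 : 0 < e / 2 by rewrite divr_gt0.
have [V [V' hV] UV] := hU _ e2; have [p [Vp _]] := hV _ e2.
exists p; rewrite -(subrKA V) [leRHS]splitr.
by apply: le_trans (opnorm_leD _ _) _; apply: lerD.
Qed.

Lemma dominated_extension : exists phi : bop K -> bop H,
  completely_contractive_representation A phi /\ phi \o iota = pi.
Proof.
have [_ Alin Amul _] := oa_closed_subalgebra A.
have /choice[phi hphi] : forall T, exists S, oa_set A T -> is_ext T S.
  move=> T; have [/is_ext_exists[S hS]|nA] := pselect (oa_set A T).
    by exists S.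
  by exists 0 => /nA.
exists phi; split; last first.
  apply/funext => x /=.
  apply: (is_ext_unique (hphi _ (generated_algebra_gen x))).
  exact: (is_ext_nc_eval (NCVar x)).
split; first split.
- move=> c S T AS AT; apply: (is_ext_unique (hphi _ (Alin _ _ _ AS AT))).
  by apply: is_ext_lin; exact: hphi.
- move=> S T AS AT; apply: (is_ext_unique (hphi _ (Amul _ _ AS AT))).
  by apply: is_ext_mul; exact: hphi.
by move=> n T AT; apply: is_ext_mx => i j; rewrite mxE; exact: hphi.
Qed.

End Extension.

(** * Completely contractive representations *)

Section CompletelyContractive.
Variables (R : realType) (A : operator_algebra R) (H : hilbert R).
Variable phi : bop (oa_space A) -> bop H.
Hypothesis phi_rep : completely_contractive_representation A phi.

Let A_alg := oa_closed_subalgebra A.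

Lemma rep_contr T : oa_set A T -> opnorm (phi T) <= opnorm T.
Proof.
move=> AT; have [_ /(_ 1%N (const_mx T))] := phi_rep.
by rewrite map_const_mx !mxnorm1; apply => i j; rewrite mxE.
Qed.

Lemma rep0 : phi 0 = 0.
Proof.
have [A0 _ _ _] := A_alg.
have [[lin _] _] := phi_rep; have := lin 1 0 0 A0 A0.
by rewrite !scale1r addr0 => /eqP; rewrite addrC -subr_eq subrr => /eqP.
Qed.

Lemma oaB S T : oa_set A S -> oa_set A T -> oa_set A (S - T).
Proof.
by have [_ lin _ _] := A_alg => AS AT; rewrite -scaleN1r addrC; exact: lin.
Qed.

Lemma repB S T : oa_set A S -> oa_set A T -> phi (S - T) = phi S - phi T.
Proof.
have [[lin _] _] := phi_rep => AS AT.
by rewrite -scaleN1r addrC lin// scaleN1r addrC.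
Qed.

Lemma rep_dist S T : oa_set A S -> oa_set A T ->
  opnorm (phi S - phi T) <= opnorm (S - T).
Proof. by move=> AS AT; rewrite -repB//; apply: rep_contr; exact: oaB. Qed.

(** Reduces inclusions between generated algebras to their generators. *)
Lemma closed_subalgebra_preimage (B : set (bop H)) : closed_subalgebra B ->
  closed_subalgebra [set T | oa_set A T /\ B (phi T)].
Proof.
move=> [B0 Blin Bmul Bc]; have [A0 Alin Amul Ac] := A_alg.
have [[lin mul] _] := phi_rep.
apply: closed_subalgebra_rnorm => /=.
- by rewrite rep0.
- by move=> c S T [AS BS] [AT BT]; rewrite lin//; split;
    [exact: Alin|exact: Blin].
- by move=> S T [AS BS] [AT BT]; rewrite mul//; split;
    [exact: Amul|exact: Bmul].
move=> T hT.
have AT : oa_set A T.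
  apply: (closed_rnormP _).2 => // e e0.
  by have [S [AS _] ST] := hT e e0; exists S.
split=> //; apply: (closed_rnormP _).2 => // e e0.
have [S [AS BS] ST] := hT e e0.
by exists (phi S) => //; apply: le_trans (rep_dist AT AS) ST.
Qed.

End CompletelyContractive.

Lemma rep_unique (R : realType) (X : Type) (A : operator_algebra R)
    (H : hilbert R) (iota : X -> bop (oa_space A))
    (phi psi : bop (oa_space A) -> bop H) :
  smallest (@closed_subalgebra R (oa_space A)) (range iota) = oa_set A ->
  completely_contractive_representation A phi ->
  completely_contractive_representation A psi ->
  phi \o iota = psi \o iota -> forall T, oa_set A T -> phi T = psi T.
Proof.
move=> genA hphi hpsi e T AT.
suff: [set T | oa_set A T /\ phi T = psi T] T by case.
move: AT; rewrite -{1}genA; apply: smallest_subalgebra_ind; last first.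
  move=> _ [x _ <-]; split; last exact: (congr1 (@^~ x) e).
  by rewrite -genA => B [_]; apply; exists x.
have [A0 Alin Amul Ac] := oa_closed_subalgebra A.
have [[lin mul] _] := hphi; have [[lin' mul'] _] := hpsi.
apply: closed_subalgebra_rnorm => /=.
- by rewrite (rep0 hphi) (rep0 hpsi).
- move=> c U V [AU eU] [AV eV]; rewrite lin// lin'// eU eV.
  by split=> //; exact: Alin.
- move=> U V [AU eU] [AV eV]; rewrite mul// mul'// eU eV.
  by split=> //; exact: Amul.
move=> U hU.
have AU : oa_set A U.
  apply: (closed_rnormP _).2 => // d d0.
  by have [S [AS _] ST] := hU d d0; exists S.
split=> //; apply/eqP; rewrite -subr_eq0; apply/eqP.
apply: (@rnorm_le0P _ (bop H)) => d d0; rewrite -/(opnorm _).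
have d2 : 0 < d / 2 by rewrite divr_gt0.
have [S [AS eS] US] := hU _ d2.
rewrite -(subrKA (phi S)) [leRHS]splitr; apply: le_trans (opnorm_leD _ _) _.
apply: lerD; first exact: le_trans (rep_dist hphi AU AS) US.
rewrite eS opnorm_distC; exact: le_trans (rep_dist hpsi AU AS) US.
Qed.

Lemma rep_id (R : realType) (A : operator_algebra R) :
  completely_contractive_representation A (@id (bop (oa_space A))).
Proof. by split=> // n T _; rewrite map_mx_id. Qed.

Lemma rep_comp (R : realType) (A B : operator_algebra R) (H : hilbert R)
    (phi : bop (oa_space A) -> bop (oa_space B))
    (psi : bop (oa_space B) -> bop H) :
  completely_contractive_representation A phi ->
  (forall T, oa_set A T -> oa_set B (phi T)) ->
  completely_contractive_representation B psi ->
  completely_contractive_representation A (psi \o phi).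
Proof.
move=> [[lin mul] cc] AB [[lin' mul'] cc']; split; first split.
- by move=> c S T AS AT /=; rewrite lin// lin'//; exact: AB.
- by move=> S T AS AT /=; rewrite mul// mul'//; exact: AB.
move=> n T AT; rewrite map_mx_comp; apply: le_trans (cc n T AT).
by apply: cc' => i j; rewrite mxE; exact: AB.
Qed.

(** * The universal representation *)

Section ColoredRep.
Variables (R : realType) (G : digraph) (f : edge G -> nat).
Hypothesis f_gt0 : forall e : edge G, (0 < f e)%N.

Lemma projection_contr (H : hilbert R) (P : bop H) x :
  is_projection P -> rnorm (P x) <= rnorm x.
Proof.
move=> [PP Pself]; rewrite -ler_sqr ?nnegrE ?rnorm_ge0// -lecR -!inner_rnorm.
have orth : inner H (P x) (x - P x) = 0.
  have P0 : P (x - P x) = 0 by rewrite linearB /= -[P (P x)]bopME PP subrr.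
  by rewrite Pself P0 linear0r.
by rewrite -[in leRHS](subrK (P x) x) addrC hnormDd// lerDl dnorm_ge0.
Qed.

Lemma row_contractionP (H : hilbert R) (E : Type) (T : E -> bop H) :
  row_contraction T <-> forall n (e : 'I_n -> E), injective e ->
    forall x : 'I_n -> H,
    rnorm (\sum_j T (e j) (x j)) ^+ 2 <= \sum_j rnorm (x j) ^+ 2.
Proof.
have actE n (e : 'I_n -> E) (x : 'I_n -> H) :
    l2norm (mx_act (\row_j T (e j)) x) ^+ 2 = rnorm (\sum_j T (e j) (x j)) ^+ 2.
  rewrite sqr_l2norm big_ord1; congr (rnorm _ ^+ 2).
  by apply: eq_bigr => j _; rewrite mxE.
split=> h n e inj_e => [x|].
  rewrite -actE -sqr_l2norm ler_sqr ?nnegrE ?l2norm_ge0//.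
  apply: le_trans (mxnormP _ _) _; rewrite -[leRHS]mul1r.
  by rewrite ler_wpM2r ?l2norm_ge0//; exact: h.
apply: mxnorm_le ler01 _ => x.
by rewrite mul1r -ler_sqr ?nnegrE ?l2norm_ge0// actE sqr_l2norm; exact: h.
Qed.

(** An edge is contractive as a row with a single entry. *)
Lemma colored_rep_contr (H : hilbert R) (pi : digraph_elt G -> bop H) :
  contractive_colored_rep f pi -> forall g x, rnorm (pi g x) <= rnorm x.
Proof.
move=> hpi [v|e] x.
  by have [/(_ v)/projection_contr] := hpi 1%N isT.
have [_ _ _ /row_contractionP] := hpi (f e) (f_gt0 e).
move=> /(_ 1%N (fun=> exist _ e erefl)) h.
have /h/(_ (fun=> x)) :
    injective (fun _ : 'I_1 => exist (fun e' => f e' = f e) e erefl).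
  by move=> i j _; rewrite !ord1.
by rewrite !big_ord1 /= ler_sqr ?nnegrE ?rnorm_ge0.
Qed.

(** The index type of the universal direct sum. Representations occur in it
only under an existential quantifier, so that it is small enough to index a
direct sum although it refers to all of them. *)
Record test := Test {
  test_dim : nat;
  test_mx : 'M[nc_poly R (digraph_elt G)]_test_dim;
  test_bound : R;
  test_attained : exists H : hilbert R,
    exists2 pi : digraph_elt G -> bop H, contractive_colored_rep f pi
      & test_bound <= mxnorm (map_mx (nc_eval pi) test_mx) }.

Definition test_space (t : {classic test}) : hilbert R :=
  sval (cid (test_attained t)).

Definition test_rep_exists (t : {classic test}) :=
  cid2 (svalP (cid (test_attained t))).

Definition test_rep (t : {classic test}) : digraph_elt G -> bop (test_space t) :=
  s2val (test_rep_exists t).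

Lemma test_rep_colored t : contractive_colored_rep f (test_rep t).
Proof. exact: s2valP (test_rep_exists t). Qed.

Lemma test_rep_bound (t : {classic test}) :
  test_bound t <= mxnorm (map_mx (nc_eval (test_rep t)) (test_mx t)).
Proof. exact: s2valP' (test_rep_exists t). Qed.

Definition universal_space := hilbert_sum test_space.

Lemma test_rep_contr g t x : rnorm (test_rep t g x) <= rnorm x.
Proof. exact: colored_rep_contr (test_rep_colored t) _ _. Qed.

Definition universal_rep (g : digraph_elt G) : bop universal_space :=
  diag (test_rep_contr g).

Lemma nc_eval_coord p (x : universal_space) t :
  (nc_eval universal_rep p x : direct_sum test_space) t
  = nc_eval (test_rep t) p ((x : direct_sum test_space) t).
Proof.
elim: p x => [//|//|c p IHp q IHq|p IHp q IHq] x.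
  exact: (congr2 (fun a b => c *: a + b) (IHp x) (IHq x)).
exact: etrans (IHp _) (congr1 (nc_eval (test_rep t) p) (IHq x)).
Qed.

(** The norm of [p] at [pi] is itself one of the bounds, so some summand attains
it; vectors supported in that summand show that the norm at the direct sum is
at least as large. *)
Lemma universal_rep_dominates (H : hilbert R) (pi : digraph_elt G -> bop H) n
    (p : 'M[nc_poly R (digraph_elt G)]_n) : contractive_colored_rep f pi ->
  mxnorm (map_mx (nc_eval pi) p) <= mxnorm (map_mx (nc_eval universal_rep) p).
Proof.
move=> hpi.
have att : exists H' : hilbert R, exists2 pi' : digraph_elt G -> bop H',
    contractive_colored_rep f pi' &
    mxnorm (map_mx (nc_eval pi) p) <= mxnorm (map_mx (nc_eval pi') p).
  by exists H, pi.
pose t : {classic test} := Test att.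
apply: le_trans (test_rep_bound t) _; apply: mxnorm_le (mxnorm_ge0 _) _ => x.
pose y : 'I_n -> universal_space := fun j => embed (x j : test_space t).
apply: (@le_trans _ _ (l2norm (mx_act (map_mx (nc_eval universal_rep) p) y))).
  apply: l2norm_ler; apply: ler_sum => i _.
  rewrite ler_sqr ?nnegrE ?rnorm_ge0//.
  apply: le_trans (rnorm_coord (_ : direct_sum test_space) t).
  rewrite le_eqVlt; apply/predU1P; left; congr rnorm.
  rewrite /mx_act ds_sum; apply: eq_bigr => j _.
  by rewrite !mxE nc_eval_coord embed_in.
apply: le_trans (mxnormP _ _) _; rewrite ler_wpM2l ?mxnorm_ge0//.
apply: l2norm_ler; apply: ler_sum => j _.
by rewrite ler_sqr ?nnegrE ?rnorm_ge0// rnorm_embed.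
Qed.

Local Notation iota := universal_rep.

(** All the conditions are checked coordinatewise; for rows this uses that the
sum over the summands and the finite sum over the row can be exchanged. *)
Lemma universal_rep_colored : contractive_colored_rep f iota.
Proof.
have hj t := @test_rep_colored t.
move=> j j0; split.
- move=> v; split.
    apply: bop_ext => x; apply: ds_ext => t.
    have [/(_ v)[PP _] _ _ _] := hj t j j0.
    exact: (congr1 (fun T : bop _ => T _) PP).
  move=> x y; apply: ds_inner_unique.
  rewrite (_ : partial_inner _ _ = partial_inner x (iota (inl v) y)).
    exact: ds_inner_cvg.
  apply/funext => A; apply: eq_bigr => t _.
  by have [/(_ v)[_ Pself] _ _ _] := hj t j j0; exact: Pself.
- move=> v w vw; apply: bop_ext => x; apply: ds_ext => t.
  have [_ /(_ v w vw) PQ _ _] := hj t j j0.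
  exact: (congr1 (fun T : bop _ => T _) PQ).
- move=> e; apply: bop_ext => x; apply: ds_ext => t.
  have [_ _ /(_ e) PTP _] := hj t j j0.
  exact: (congr1 (fun T : bop _ => T _) PTP).
apply/row_contractionP => n e inj_e x.
rewrite sqr_rnorm_ds; apply: sqnorm_le => A.
apply: (@le_trans _ _ (\sum_k partial_sqnorm (x k : direct_sum _) A)).
  rewrite /partial_sqnorm exchange_big /=; apply: ler_sum => t _.
  have [_ _ _ /row_contractionP] := hj t j j0.
  move=> /(_ n e inj_e (fun k => (x k : direct_sum _) t)).
  apply: le_trans; rewrite le_eqVlt; apply/predU1P; left; congr (rnorm _ ^+ 2).
  exact: ds_sum.
by apply: ler_sum => k _; rewrite sqr_rnorm_ds; exact: sqnorm_ub.
Qed.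

Lemma universal_algebra_exists :
  universal_algebra f (generated_algebra iota) iota.
Proof.
split=> // [|H pi hpi]; first exact: universal_rep_colored.
have dom n (p : 'M[_]_n) := universal_rep_dominates p hpi.
have [phi [hphi phiE]] := dominated_extension dom.
exists phi => // psi hpsi psiE T AT.
by apply: rep_unique hphi hpsi _ T AT => //; rewrite phiE psiE.
Qed.

End ColoredRep.

(** * Uniqueness of universal algebras *)

Section Uniqueness.
Variables (R : realType) (G : digraph) (f : edge G -> nat).

Lemma universal_comparison (A B : operator_algebra R)
    (iA : digraph_elt G -> bop (oa_space A))
    (iB : digraph_elt G -> bop (oa_space B)) :
  universal_algebra f A iA -> universal_algebra f B iB ->
  exists phi : bop (oa_space A) -> bop (oa_space B),
    [/\ completely_contractive_representation A phi, phi \o iA = iB &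
      forall T, oa_set A T -> oa_set B (phi T)].
Proof.
move=> [_ genA univA] [colB genB _].
have [phi [hphi phiE] _] := univA _ _ colB; exists phi; split=> // T AT.
suff: [set T | oa_set A T /\ oa_set B (phi T)] T by case.
move: AT; rewrite -{1}genA; apply: smallest_subalgebra_ind.
  exact: (closed_subalgebra_preimage hphi (oa_closed_subalgebra B)).
move=> _ [x _ <-] /=; rewrite -[phi _]/((phi \o iA) x) phiE -genA -genB.
by split=> C [_]; apply; exists x.
Qed.

Lemma universal_unique (A B : operator_algebra R)
    (iA : digraph_elt G -> bop (oa_space A))
    (iB : digraph_elt G -> bop (oa_space B)) :
  universal_algebra f A iA -> universal_algebra f B iB ->
  exists phi : bop (oa_space A) -> bop (oa_space B),
    completely_isometric_isomorphism A B phi /\ phi \o iA = iB.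
Proof.
move=> uA uB.
have [phi [hphi phiE phiAB]] := universal_comparison uA uB.
have [psi [hpsi psiE psiBA]] := universal_comparison uB uA.
have psiK T : oa_set A T -> psi (phi T) = T.
  have [_ genA _] := uA.
  apply: (rep_unique genA (rep_comp hphi phiAB hpsi) (rep_id A)).
  by rewrite -compA phiE psiE.
have phiK T : oa_set B T -> phi (psi T) = T.
  have [_ genB _] := uB.
  apply: (rep_unique genB (rep_comp hpsi psiBA hphi) (rep_id B)).
  by rewrite -compA psiE phiE.
exists phi; split=> //; split; first by case: hphi.
  split=> [T|S T|T BT]; first exact: phiAB.
    by rewrite !inE => AS AT e; rewrite -(psiK S)// e psiK.
  by exists (psi T); [exact: psiBA|exact: phiK].
move=> n T AT; apply/eqP; rewrite eq_le; apply/andP; split.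
  by have [_ cc] := hphi; exact: cc.
have [_ cc] := hpsi.
rewrite -[T in leLHS](_ : map_mx psi (map_mx phi T) = T).
  by apply: cc => i j; rewrite mxE; exact: phiAB.
by apply/matrixP => i j; rewrite !mxE psiK.
Qed.

End Uniqueness.

Theorem theorem4 (R : realType) (G : digraph) (f : edge G -> nat)
    (f_gt0 : forall e : edge G, (0 < f e)%N) :
  (exists (A : operator_algebra R) (iota : digraph_elt G -> bop (oa_space A)),
     universal_algebra f A iota)
  /\ (forall (A B : operator_algebra R)
        (iotaA : digraph_elt G -> bop (oa_space A))
        (iotaB : digraph_elt G -> bop (oa_space B)),
        universal_algebra f A iotaA -> universal_algebra f B iotaB ->
        exists phi : bop (oa_space A) -> bop (oa_space B),
          completely_isometric_isomorphism A B phi /\ phi \o iotaA = iotaB).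
Proof.
split; last by move=> A B iotaA iotaB; exact: universal_unique.
exists (generated_algebra (universal_rep R f_gt0)), (universal_rep R f_gt0).
exact: universal_algebra_exists.
Qed.
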